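(* Let $S = \langle s_1, \ldots, s_n \rangle$ be a finite sequence of policy values in $V_6$. Then $$\delta\Bigl(\bigoplus\nolimits_{\mathbf{f\text{-}a}}^{V_6}(S)\Bigr) = \bigoplus\nolimits_{\mathbf{f\text{-}a}}^{\mathbf{P}}(\delta(S)).$$ That is, the first-applicable combining algorithm under $V_6$ and the first-applicable combining algorithm under $\mathbf{P}$ agree via $\delta$.
   Context: $V_6 = \{\top_{\mathbf{p}}, \top_{\mathbf{d}}, I_{\mathbf{d}}, I_{\mathbf{p}}, I_{\mathbf{dp}}, \bot\}$ is a set of six distinct values. The set of pairwise policy values is $\mathbf{P} = \{[0,0], [\frac12,0], [0,\frac12], [\frac12,\frac12], [1,0], [0,1]\}$. The map $\delta : V_6 \to \mathbf{P}$ is: $\delta(\bot) = [0,0]$, $\delta(I_{\mathbf{d}}) = [\frac12,0]$, $\delta(I_{\mathbf{p}}) = [0,\frac12]$, $\delta(I_{\mathbf{dp}}) = [\frac12,\frac12]$, $\delta(\top_{\mathbf{d}}) = [1,0]$, $\delta(\top_{\mathbf{p}}) = [0,1]$. On sequences $\delta$ is applied elementwise: $\delta(\langle s_1,\dots,s_n\rangle) = \langle \delta(s_1), \dots, \delta(s_n)\rangle$. First-applicable under $V_6$. For a sequence $S = \langle s_1, \ldots, s_n\rangle$ in $V_6$, $\bigoplus_{\mathbf{f\text{-}a}}^{V_6}(S) = s_i$ if there is an index $i$ with $s_i \neq \bot$ and $s_j = \bot$ for all $j < i$; otherwise $\bigoplus_{\mathbf{f\text{-}a}}^{V_6}(S)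 = \bot$. First-applicable under $\mathbf{P}$. For a sequence $S = \langle s_1, \ldots, s_n\rangle$ in $\mathbf{P}$, $\bigoplus_{\mathbf{f\text{-}a}}^{\mathbf{P}}(S) = s_i$ if there is an index $i$ with $s_i \neq [0,0]$ and $s_j = [0,0]$ for all $j < i$; otherwise $\bigoplus_{\mathbf{f\text{-}a}}^{\mathbf{P}}(S) = [0,0]$. *)

(* Defs.v *)
From HB Require Import structures.
From mathcomp Require Import all_boot all_order all_algebra.

Set Implicit Arguments.
Unset Strict Implicit.
Unset Printing Implicit Defensive.

Inductive V6 : Type := top_p | top_d | I_d | I_p | I_dp | bot.

Definition V6_comparable : comparable V6.
Proof. by unfold comparable, decidable; decide equality. Defined.

HB.instance Definition _ := hasDecEq.Build V6 (compareP V6_comparable).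

(* The pair [a, b] is the rational pair (a, b). *)
Definition P_values : seq (rat * rat) :=
  [:: (0, 0); (1 / 2%:R, 0); (0, 1 / 2%:R); (1 / 2%:R, 1 / 2%:R);
      (1, 0); (0, 1)]%R.

Definition P : Type := seq_sub P_values.

Lemma zero_in_P : (0, 0)%R \in P_values.
Proof. by []. Qed.

Definition P0 : P := SeqSub zero_in_P.

Definition delta_pair (v : V6) : rat * rat :=
  match v with
  | bot => (0, 0)
  | I_d => (1 / 2%:R, 0)
  | I_p => (0, 1 / 2%:R)
  | I_dp => (1 / 2%:R, 1 / 2%:R)
  | top_d => (1, 0)
  | top_p => (0, 1)
  end%R.

Lemma delta_pair_in_P (v : V6) : delta_pair v \in P_values.
Proof. by case: v. Qed.

Definition delta (v : V6) : P := SeqSub (delta_pair_in_P v).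

(* There is at most one index satisfying the condition, so the choice made by
   [pick] is immaterial. *)
Definition first_applicable (T : eqType) (e : T) (n : nat)
    (S : n.-tuple T) : T :=
  if [pick i : 'I_n | (tnth S i != e)
        && [forall j : 'I_n, (j < i) ==> (tnth S j == e)]] is Some i
  then tnth S i else e.

Definition first_applicable_V6 (n : nat) (S : n.-tuple V6) : V6 :=
  first_applicable bot S.

Definition first_applicable_P (n : nat) (S : n.-tuple P) : P :=
  first_applicable P0 S.

(* Main.v *)
Require Import Defs.
From mathcomp Require Import all_boot all_order all_algebra.

(** The selected index depends only on which entries equal the default value. Since [delta] sends
    [bot], and nothing else, to [P0], it preserves that pattern and so commutes with the
    selection. *)

Lemma delta_eq_P0 (v : V6) : (delta v == P0) = (v == bot).
Proof. by case: v. Qed.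

Lemma first_applicable_map (T U : eqType) (f : T -> U) (e : T) (e' : U)
    (n : nat) (S : n.-tuple T) :
  (forall x, (f x == e') = (x == e)) ->
  f (first_applicable e S) = first_applicable e' (map_tuple f S).
Proof.
move=> fE; rewrite /first_applicable.
(* Both sides now pick with the same predicate, so one case split settles both. *)
under [in RHS]eq_pick => i.
  rewrite tnth_map fE.
  under eq_forallb => j do rewrite tnth_map fE.
  over.
case: pickP => [i _ | _]; first by rewrite tnth_map.
(* No index qualifies: [f e = e'] is [fE] at [e]. *)
by apply/eqP; rewrite fE.
Qed.

Theorem proposition4 (n : nat) (S : n.-tuple V6) :
  delta (first_applicable_V6 S) = first_applicable_P (map_tuple delta S).
Proof. exact: first_applicable_map delta_eq_P0. Qed.
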